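(* Let $X, Z\in \mathbb{R}^{n\times d}$ and let $\Sigma\in\mathbb{R}^{d\times d}$ be a symmetric positive semidefinite matrix such that $X= Z\Sigma^{1/2}$, and let $\hat{\Sigma}:=\frac{1}{n}X^\top X$. 1. If $d\leq n$, then for every $1\le i\le d$, $$\left|\lambda_i(\hat\Sigma) - \lambda_i(\Sigma)\right| \leq \lambda_i(\Sigma)\left\|\tfrac{1}{n}Z^\top Z - I_d\right\|_2.$$ 2. If $d \geq n$, then for every $1\le i\le n$, $$\lambda_{i+d-n}(\Sigma)\left(1 - \left\|\tfrac{1}{d}ZZ^\top - I_n\right\|_2\right) \leq \frac{n}{d}\, \lambda_i(\hat\Sigma) \leq \lambda_i(\Sigma)\left(1 + \left\|\tfrac{1}{d}ZZ^\top - I_n\right\|_2\right).$$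
   Context: $\lambda_i(\cdot)$ denotes the $i$-th largest eigenvalue of a symmetric matrix ($\lambda_1\geq\lambda_2\geq\dots$). $\|\cdot\|_2$ is the spectral norm (operator 2-norm) of a matrix. $I_n$ is the $n\times n$ identity matrix. $\Sigma^{1/2}$ is the positive semidefinite square root. *)

(* Defs.v *)
From mathcomp Require Import all_boot all_order all_algebra.
From mathcomp Require Import polyrcf.
From mathcomp Require Import all_classical all_reals.

Set Implicit Arguments.
Unset Strict Implicit.
Unset Printing Implicit Defensive.

Import Order.TTheory GRing.Theory Num.Theory.

Local Open Scope classical_set_scope.
Local Open Scope ring_scope.

(* [rootsR p] lists the real roots of [p] without repetition, hence the
   [nseq]; a symmetric matrix of size n has exactly n eigenvalues here. *)
Definition eigenvalues (R : realType) (n : nat) (A : 'M[R]_n) : seq R :=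
  sort >=%R (flatten [seq nseq (mup x (char_poly A)) x
                     | x <- rootsR (char_poly A)]).

(* Indices start at 1: [lambda 1 A] is the largest eigenvalue.  Only meaningful
   for [A] symmetric and 1 <= i <= n. *)
Definition lambda (R : realType) (n : nat) (i : nat) (A : 'M[R]_n) : R :=
  nth 0 (eigenvalues A) i.-1.

Definition norm2 (R : realType) (n : nat) (x : 'cV[R]_n) : R :=
  Num.sqrt (\sum_(i < n) x i 0 ^+ 2).

(* The norm that MathComp-Analysis puts on ['M_(m, n)] is the largest absolute
   value of an entry, not this one. *)
Definition opnorm2 (R : realType) (m n : nat) (A : 'M[R]_(m, n)) : R :=
  sup [set norm2 (A *m x) | x in [set x : 'cV[R]_n | norm2 x <= 1]].

Definition psdmx (R : realType) (n : nat) (A : 'M[R]_n) : Prop :=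
  A^T = A /\ forall x : 'cV[R]_n, 0 <= (x^T *m A *m x) 0 0.

(* For [A] positive semidefinite there is exactly one such [S]; otherwise there
   is none and the value is the dummy 0. *)
Definition sqrtmx (R : realType) (n : nat) (A : 'M[R]_n) : 'M[R]_n :=
  xget 0 [set S : 'M[R]_n | psdmx S /\ S *m S = A].

Definition sample_cov (R : realType) (n d : nat) (X : 'M[R]_(n, d)) : 'M[R]_d :=
  n%:R^-1 *: (X^T *m X).

(* Main.v *)
(** With [S = Sigma^(1/2)], the covariance [Shat = S Z^T Z S / n] satisfies
    [n <v Shat, v> = |v S Z^T|^2] and [<v Sigma, v> = |v S|^2], so
    eigenvalues are compared through quadratic forms and the Courant-Fischer
    principle.

    If [d <= n], with [e] the norm of [Z^T Z / n - I], the form of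
    [Shat] lies between [1 - e] and [1 + e] times that of [Sigma].  If [n <= d],
    the upper bound is similar.  For the lower bound, let [W] be the span of the top
    [i + d - n] eigenvectors of [Sigma]; the preimage of [W] under [v |-> v Z]
    has dimension at least [i], and its image under [v |-> v Z S] is a subspace
    on which the form of [Shat] is large. *)
Require Import Defs.
From mathcomp Require Import all_boot all_order all_algebra.
From mathcomp Require Import complex polyrcf.
From mathcomp Require Import all_classical all_reals.
From mathcomp Require Import ring lra zify.

Set Implicit Arguments.
Unset Strict Implicit.
Unset Printing Implicit Defensive.

Import Order.TTheory GRing.Theory Num.Theory.
Local Open Scope ring_scope.

(** * Euclidean inner product on row vectors *)

Definition dot {R : comPzRingType} {n : nat} (u v : 'rV[R]_n) : R :=
  (u *m v^T) 0 0.

Lemma dotE (R : comPzRingType) n (u v : 'rV[R]_n) :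
  dot u v = \sum_i u 0 i * v 0 i.
Proof. by rewrite /dot mxE; apply: eq_bigr => i _; rewrite mxE. Qed.

Lemma dotC (R : comPzRingType) n (u v : 'rV[R]_n) : dot u v = dot v u.
Proof. by rewrite !dotE; apply: eq_bigr => i _; rewrite mulrC. Qed.

Lemma dotDl (R : comPzRingType) n (u v w : 'rV[R]_n) :
  dot (u + v) w = dot u w + dot v w.
Proof. by rewrite /dot mulmxDl mxE. Qed.

Lemma dotDr (R : comPzRingType) n (u v w : 'rV[R]_n) :
  dot u (v + w) = dot u v + dot u w.
Proof. by rewrite dotC dotDl !(dotC u). Qed.

Lemma dotZl (R : comPzRingType) n a (u v : 'rV[R]_n) :
  dot (a *: u) v = a * dot u v.
Proof. by rewrite /dot -scalemxAl mxE. Qed.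

Lemma dotZr (R : comPzRingType) n a (u v : 'rV[R]_n) :
  dot u (a *: v) = a * dot u v.
Proof. by rewrite dotC dotZl dotC. Qed.

Lemma dotNl (R : comPzRingType) n (u v : 'rV[R]_n) : dot (- u) v = - dot u v.
Proof. by rewrite /dot mulNmx mxE. Qed.

Lemma dotBl (R : comPzRingType) n (u v w : 'rV[R]_n) :
  dot (u - v) w = dot u w - dot v w.
Proof. by rewrite dotDl dotNl. Qed.

Lemma dotBr (R : comPzRingType) n (u v w : 'rV[R]_n) :
  dot u (v - w) = dot u v - dot u w.
Proof. by rewrite dotC dotBl !(dotC u). Qed.

Lemma dot_mulmx (R : comPzRingType) m n (u : 'rV[R]_m) (A : 'M[R]_(m, n)) v :
  dot (u *m A) v = dot u (v *m A^T).
Proof. by rewrite /dot trmx_mul trmxK mulmxA. Qed.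

Lemma dot_ge0 (R : realDomainType) n (u : 'rV[R]_n) : 0 <= dot u u.
Proof. by rewrite dotE sumr_ge0 // => i _; rewrite -expr2 sqr_ge0. Qed.

Lemma dot_eq0 (R : realDomainType) n (u : 'rV[R]_n) : (dot u u == 0) = (u == 0).
Proof.
apply/idP/idP => [|/eqP ->]; last by rewrite /dot mul0mx mxE.
rewrite dotE psumr_eq0 => [/allP u0|i _]; last by rewrite -expr2 sqr_ge0.
apply/eqP/rowP => i; rewrite mxE; apply/eqP.
by have := u0 i (mem_index_enum _); rewrite /= mulf_eq0 orbb.
Qed.

Lemma dot_gt0 (R : realDomainType) n (u : 'rV[R]_n) : (0 < dot u u) = (u != 0).
Proof. by rewrite lt_def dot_eq0 dot_ge0 andbT. Qed.

(** With c = |v|^2, expanding |c u - <u, v> v|^2 >= 0 gives c (c |u|^2 - <u, v>^2) >= 0, and c > 0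
    cancels. *)
Lemma cauchy_schwarz (R : realFieldType) n (u v : 'rV[R]_n) :
  dot u v ^+ 2 <= dot u u * dot v v.
Proof.
have [->|v0] := eqVneq v 0.
  by rewrite {1}/dot trmx0 mulmx0 mxE expr0n mulr_ge0 ?dot_ge0.
have := dot_ge0 (dot v v *: u - dot u v *: v).
rewrite !(dotBl, dotBr, dotZl, dotZr) (dotC v u).
set a := dot u u; set b := dot u v; set c := dot v v => h.
have c0 : 0 < c by rewrite /c dot_gt0.
rewrite -subr_ge0 -(pmulr_rge0 _ c0).
by apply: le_trans h _; rewrite le_eqVlt; apply/orP; left; apply/eqP; ring.
Qed.

(** * Spectral theorem for real symmetric matrices *)

(* If [x + i y] is an eigenvector for [a + i b], symmetry of [A] applied to the
   pair [x, y] gives [b (|x|^2 + |y|^2) = 0]. *)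
Lemma symmetric_eigenvector (R : rcfType) n (A : 'M[R]_n.+1) :
  A^T = A -> exists a (v : 'rV[R]_n.+1), v != 0 /\ v *m A = a *: v.
Proof.
move=> Asym.
have [[a b] /eigenvalueP [u uA u0]] :=
  eigenvalue_closed (map_mx (real_complex R) A) (ltn0Sn n).
have ReD (z t : R[i]) : complex.Re (z + t) = complex.Re z + complex.Re t.
  by case: z t => [? ?] [? ?].
have ImD (z t : R[i]) : complex.Im (z + t) = complex.Im z + complex.Im t.
  by case: z t => [? ?] [? ?].
set x := map_mx (@complex.Re R) u; set y := map_mx (@complex.Im R) u.
have xA : x *m A = a *: x - b *: y.
  apply/rowP => j; have /rowP/(_ j)/(congr1 (@complex.Re R)) := uA.
  rewrite !mxE (big_morph _ ReD (erefl _)); case: (u 0 j) => c d /= <-.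
  apply: eq_bigr => i _; rewrite !mxE; case: (u 0 i) => ? ? /=.
  by rewrite mulr0 subr0.
have yA : y *m A = b *: x + a *: y.
  apply/rowP => j; have /rowP/(_ j)/(congr1 (@complex.Im R)) := uA.
  rewrite !mxE (big_morph _ ImD (erefl _)); case: (u 0 j) => c d /= uAj.
  rewrite [RHS]addrC -uAj.
  apply: eq_bigr => i _; rewrite !mxE; case: (u 0 i) => ? ? /=.
  by rewrite mulr0 add0r.
have xy0 : (x != 0) || (y != 0).
  rewrite -negb_and; apply: contra u0 => /andP [/eqP/rowP x0 /eqP/rowP y0].
  apply/eqP/rowP => j; have := x0 j; have := y0 j; rewrite !mxE.
  by case: (u 0 j) => c d /= -> ->.
have b0 : b = 0.
  have := dot_mulmx x A y; rewrite Asym xA yA.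
  rewrite !(dotBl, dotDr, dotZl, dotZr) => h.
  have /eqP : b * (dot x x + dot y y) = 0 by lra.
  rewrite mulf_eq0 => /orP [/eqP //|].
  by rewrite paddr_eq0 ?dot_ge0 // !dot_eq0 -[_ && _]negbK negb_and xy0.
case/orP: xy0 => [x0|y0]; [exists a, x|exists a, y]; split => //.
  by rewrite xA b0 scale0r subr0.
by rewrite yA b0 scale0r add0r.
Qed.

(* The Householder reflection exchanging [v] and the first basis vector. *)
Lemma unit_row_orthogonal (R : realFieldType) n (v : 'rV[R]_n.+1) :
  dot v v = 1 ->
  exists Q : 'M[R]_n.+1, Q *m Q^T = 1%:M /\ delta_mx 0 0 *m Q = v.
Proof.
move=> v1; pose e : 'rV[R]_n.+1 := delta_mx 0 0.
have [->|ve] := eqVneq v e.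
  by exists 1%:M; rewrite trmx1 !mulmx1.
pose w := e - v; pose c := dot w w.
have c0 : c != 0 by rewrite /c dot_eq0 subr_eq0 eq_sym.
have ee : dot e e = 1.
  rewrite dotE (bigD1 0) //= big1 ?addr0 ?mxE ?mulr1 // => i i0.
  by rewrite mxE (negbTE i0) mulr0.
(* This rests on |e| = |v| = 1; it is what makes the reflection send [e] to e - w = v. *)
have cE : c = 2 * dot e w.
  rewrite /c /w !(dotBl, dotBr) v1 ee (dotC v e); ring.
have mulw m (u : 'rV[R]_n.+1) (t : 'M_(_, m)) : u *m w^T *m t = dot u w *: t.
  by rewrite [u *m _]mx11_scalar mul_scalar_mx.
pose Q := 1%:M - (2 / c) *: (w^T *m w).
have Qt : Q^T = Q.
  by rewrite /Q linearB /= trmx1 linearZ /= trmx_mul trmxK.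
exists Q; split; last first.
  rewrite -/e /Q mulmxBr mulmx1 -scalemxAr mulmxA mulw scalerA.
  have -> : 2 / c * dot e w = 1.
    by rewrite mulrAC -cE divff.
  by rewrite scale1r /w opprB addrC subrK.
have ww : w^T *m w *m (w^T *m w) = c *: (w^T *m w).
  by rewrite -mulmxA [w *m _]mulmxA mulw scalemxAr.
rewrite Qt /Q mulmxBr mulmx1 mulmxBl mul1mx -scalemxAr -scalemxAl ww.
rewrite !scalerA; have -> : 2 / c * (2 / c) * c = 2 / c + 2 / c by field.
by rewrite scalerDl opprB addrK subrK.
Qed.

(** Induction on the size: conjugating by an orthogonal matrix whose first row is a unit eigenvector
    clears the rest of the first row, symmetry clears the first column, and the remaining block is
    diagonalized by induction. *)
Theorem real_spectral (R : rcfType) n (A : 'M[R]_n) :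
  A^T = A ->
  exists (Q : 'M[R]_n) (D : 'rV[R]_n),
    Q *m Q^T = 1%:M /\ A = Q^T *m diag_mx D *m Q.
Proof.
elim: n A => [|n IHn] A Asym.
  by exists 1%:M, 0; split; apply/matrixP => -[].
have [a [v [v0 vA]]] := symmetric_eigenvector Asym.
have vv : 0 < dot v v by rewrite dot_gt0.
pose s := Num.sqrt (dot v v).
have s0 : s != 0 by rewrite gt_eqF // sqrtr_gt0.
have [|Q [QQ eQ]] := @unit_row_orthogonal _ _ (s^-1 *: v).
  by rewrite dotZl dotZr mulrA -invfM -expr2 sqr_sqrtr ?ltW // mulVf ?gt_eqF.
have QtQ : Q^T *m Q = 1%:M by exact: mulmx1C.
have [B defB] : exists B, B = Q *m A *m Q^T by exists (Q *m A *m Q^T).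
have Bsym : B^T = B by rewrite defB !trmx_mul trmxK Asym mulmxA.
have eB : delta_mx 0 0 *m B = a *: delta_mx 0 0 :> 'rV_n.+1.
  rewrite defB !mulmxA eQ -scalemxAl vA scalerA mulrC -scalerA.
  by rewrite -eQ -scalemxAl -mulmxA QQ mulmx1.
pose B' : 'M[R]_(1 + n) := B.
have B00 : ulsubmx B' = a%:M.
  apply/matrixP => i j; rewrite !ord1 !mxE.
  have /rowP/(_ 0) := eB; rewrite -rowE !mxE /= mulr1 mulr1n => <-.
  by congr (B _ _); apply: val_inj.
have B01 : ursubmx B' = 0.
  apply/matrixP => i j; rewrite !ord1 !mxE.
  have /rowP/(_ (rshift 1 j)) := eB; rewrite -rowE !mxE /= mulr0 => <-.
  by congr (B _ _); apply: val_inj.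
have B'sym : B'^T = B' by [].
have B10 : dlsubmx B' = 0.
  by rewrite -[B']B'sym -trmx_ursub B01 trmx0.
have [|P [D [PP BE]]] := IHn (drsubmx B').
  by rewrite trmx_drsub B'sym.
pose W : 'M[R]_(1 + n) := block_mx 1%:M 0 0 P.
have WT : W^T = block_mx 1%:M 0 0 P^T.
  by rewrite tr_block_mx !trmx0 trmx1.
have WW : W *m W^T = 1%:M.
  rewrite WT mulmx_block.
  by rewrite !(mul0mx, mulmx0, mulmx1, addr0, add0r) PP -scalar_mx_block.
have BW : B' = W^T *m diag_mx (row_mx a%:M D) *m W.
  rewrite WT -[LHS]submxK B00 B01 B10 BE diag_mx_row !mulmx_block.
  rewrite !(mul0mx, mulmx0, mulmx1, mul1mx, addr0, add0r).
  by congr block_mx; apply/matrixP => i j; rewrite !ord1 !mxE.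
clearbody W.
exists ((W : 'M_n.+1) *m Q), (row_mx a%:M D : 'rV_(1 + n)); split.
  by rewrite trmx_mul mulmxA -[_ *m Q *m _]mulmxA QQ mulmx1.
have -> : A = Q^T *m B *m Q.
  by rewrite defB !mulmxA QtQ mul1mx -mulmxA QtQ mulmx1.
by rewrite -[B]/B' BW trmx_mul !mulmxA.
Qed.

(** * Sorted eigenvalues and coordinate subspaces *)

(** Conjugation by [Q] preserves the characteristic polynomial, which therefore splits with roots
    the entries of [D]; the multiplicity of a root is its number of occurrences there. *)
Lemma eigenvalues_spectral (R : realType) n (A Q : 'M[R]_n) (D : 'rV[R]_n) :
  Q *m Q^T = 1%:M -> A = Q^T *m diag_mx D *m Q ->
  perm_eq (eigenvalues A) [seq D 0 j | j <- enum 'I_n].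
Proof.
move=> QQ AE.
have QtQ : Q^T *m Q = 1%:M by exact: mulmx1C.
have charA :
    char_poly A = \prod_(x <- [seq D 0 j | j <- enum 'I_n]) ('X - x%:P).
  have -> : char_poly A = char_poly (diag_mx D).
    rewrite /char_poly /char_poly_mx AE !map_mxM.
    have {1}-> : 'X%:M = map_mx polyC Q^T *m 'X%:M *m map_mx polyC Q.
      by rewrite scalar_mxC -mulmxA -map_mxM QtQ map_mx1 mulmx1.
    rewrite -mulmxBl -mulmxBr !det_mulmx mulrAC -det_mulmx -map_mxM QtQ.
    by rewrite map_mx1 det1 mul1r.
  rewrite char_poly_trig ?diag_mx_is_trig // big_map big_enum.
  by apply: eq_bigr => j _; rewrite mxE eqxx.
have p0 : char_poly A != 0 by rewrite monic_neq0 ?char_poly_monic.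
rewrite /eigenvalues perm_sort; apply/allP => x _ /=.
rewrite count_flatten -map_comp sumnE big_map -(mu_prod_XsubC x) -charA.
under eq_bigr do rewrite /= count_nseq.
have [xr|xNr] := boolP (x \in rootsR (char_poly A)).
  rewrite (bigD1_seq x) ?uniq_roots //= eqxx mul1n big1 ?addn0 // => y yx.
  by rewrite (negbTE yx).
rewrite big_seq big1 => [|y yr]; last first.
  by rewrite /= (_ : (y == x) = false) //; apply: contraNF xNr => /eqP <-.
by rewrite mupNroot //; have := roots_on_rootsR p0 x; rewrite /= => ->.
Qed.

(** Positions 0 to [i] all qualify. Repeated values may add further entries, hence an inequality. *)
Lemma count_ge_nth_sorted (R : realDomainType) (s : seq R) i :
  sorted >=%R s -> (i < size s)%N -> (i < count (>= nth 0%R s i)%R s)%N.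
Proof.
move=> ss lt_i; set p := (X in count X _).
rewrite -[in count _ _](cat_take_drop i.+1 s) count_cat.
apply: leq_trans (leq_addr _ _).
have : all p (take i.+1 s).
  apply/(all_nthP 0) => j; rewrite size_takel // => lt_j; rewrite nth_take //=.
  by apply: (sorted_leq_nth ge_trans ge_refl) ss _ _ _ _ _;
    rewrite ?inE // (leq_ltn_trans _ lt_i).
by rewrite all_count => /eqP ->; rewrite size_takel.
Qed.

Lemma count_le_nth_sorted (R : realDomainType) (s : seq R) i :
  sorted >=%R s -> (size s - i <= count (<= nth 0%R s i)%R s)%N.
Proof.
move=> ss; set p := (X in count X _).
rewrite -[in count _ _](cat_take_drop i s) count_cat.
apply: leq_trans (leq_addl _ _).
have : all p (drop i s).
  apply/(all_nthP 0) => j; rewrite size_drop => lt_j; rewrite nth_drop /=.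
  have lt_ij : (i + j < size s)%N by rewrite -ltn_subRL.
  apply: (sorted_leq_nth ge_trans ge_refl 0 ss i (i + j));
    rewrite ?inE ?leq_addr //.
  by apply: leq_ltn_trans lt_ij; rewrite leq_addr.
by rewrite all_count => /eqP ->; rewrite size_drop.
Qed.

(** Each column of [Q] with index outside [S] imposes one linear condition, so the common kernel has
    codimension at most the number of such columns. *)
Lemma coordinate_subspace (F : fieldType) n (Q : 'M[F]_n) (S : pred 'I_n) :
  exists U : 'M[F]_n, (#|S| <= \rank U)%N /\
    forall v : 'rV_n, (v <= U)%MS -> forall j, ~~ S j -> (v *m Q) 0 j = 0.
Proof.
pose T := [predC S]; pose f (k : 'I_#|T|) := enum_val k.
exists (kermx (colsub f Q)); split.
  rewrite mxrank_ker; have := rank_leq_col (colsub f Q).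
  have : (#|S| + #|T| = n)%N by rewrite cardC card_ord.
  by move: (\rank _) => r; lia.
move=> v /sub_kermxP vU j Sj.
have Tj : j \in T by [].
have /rowP/(_ (enum_rank_in Tj j)) := vU.
rewrite [RHS]mxE => <-; rewrite !mxE.
by apply: eq_bigr => k _; rewrite !mxE /f enum_rankK_in.
Qed.

(** * Courant-Fischer principle *)

Section CourantFischer.

Variables (R : realType) (n : nat).
Implicit Types (A B Q : 'M[R]_n) (v : 'rV[R]_n).

Lemma spectral_dot A Q (D : 'rV[R]_n) v : A = Q^T *m diag_mx D *m Q ->
  dot (v *m A) v = \sum_j D 0 j * (v *m Q^T) 0 j ^+ 2.
Proof.
move=> ->; rewrite !mulmxA dot_mulmx dotE; apply: eq_bigr => j _.
by rewrite mul_mx_diag mxE expr2; ring.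
Qed.

Lemma spectral_norm Q v : Q *m Q^T = 1%:M ->
  dot v v = \sum_j (v *m Q^T) 0 j ^+ 2.
Proof.
move=> /mulmx1C QQ; rewrite -{1}[v]mulmx1 -QQ mulmxA dot_mulmx dotE.
by apply: eq_bigr => j _; rewrite expr2.
Qed.

(** The subspaces are spanned by the eigenvectors with eigenvalue at least, respectively at most,
    the [i]-th. Their dimensions are at least i and n - i + 1, so any subspace of dimension i meets
    the second one nontrivially. *)
Lemma lambda_subspaces A i : A^T = A -> (1 <= i <= n)%N ->
  (exists U : 'M[R]_n, (i <= \rank U)%N /\
     forall v, (v <= U)%MS -> lambda i A * dot v v <= dot (v *m A) v) /\
  (exists U : 'M[R]_n, (n < i + \rank U)%N /\
     forall v, (v <= U)%MS -> dot (v *m A) v <= lambda i A * dot v v).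
Proof.
move=> Asym /andP [i0 i_n].
have [Q [D [QQ AE]]] := real_spectral Asym.
have eigD := eigenvalues_spectral QQ AE.
have eig_sorted : sorted >=%R (eigenvalues A) 
  by apply: sort_sorted => x y; exact: le_total.
have eig_size : size (eigenvalues A) = n.
  by rewrite (perm_size eigD) size_map size_enum_ord.
have eig_count (P : pred R) : count P (eigenvalues A) = #|[pred j | P (D 0 j)]|.
  rewrite (permP eigD) count_map -sum1_count big_enum_cond /= -sum1_card.
  by apply: eq_bigl.
have i_lt : (i.-1 < size (eigenvalues A))%N by rewrite eig_size prednK.
split.
  have := count_ge_nth_sorted eig_sorted i_lt.
  rewrite prednK // eig_count -/(lambda i A) => card_i.
  have [U [rkU UP]] := coordinate_subspace Q^T [pred j | lambda i A <= D 0 j].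
  exists U; split; first exact: leq_trans card_i rkU.
  move=> v vU; rewrite (spectral_dot v AE) (spectral_norm v QQ) mulr_sumr.
  apply: ler_sum => j _.
  have [le_j|/(UP v vU) ->] := boolP (lambda i A <= D 0 j).
    by rewrite ler_wpM2r ?sqr_ge0.
  by rewrite expr0n !mulr0.
have := count_le_nth_sorted i.-1 eig_sorted.
rewrite eig_count -/(lambda i A) eig_size => card_i.
have [U [rkU UP]] := coordinate_subspace Q^T [pred j | D 0 j <= lambda i A].
exists U; split.
  by move: (leq_trans card_i rkU); move: (\rank U) => r; lia.
move=> v vU; rewrite (spectral_dot v AE) (spectral_norm v QQ) mulr_sumr.
apply: ler_sum => j _; have [le_j|/(UP v vU) ->] := boolP (D 0 j <= lambda i A).
  by rewrite ler_wpM2r ?sqr_ge0.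
by rewrite expr0n !mulr0.
Qed.

Lemma capmx_nonzero m p (U : 'M[R]_(m, n)) (W : 'M[R]_(p, n)) :
  (n < \rank U + \rank W)%N -> exists v, [/\ v != 0, (v <= U)%MS & (v <= W)%MS].
Proof.
move=> rkUW.
have cap0 : (U :&: W)%MS != 0.
  rewrite -mxrank_eq0 -lt0n; have := mxrank_sum_cap U W.
  have := rank_leq_col (U + W)%MS; lia.
exists (nz_row (U :&: W)%MS); split; first by rewrite nz_row_eq0.
  by apply: submx_trans (nz_row_sub _) (capmxSl _ _).
by apply: submx_trans (nz_row_sub _) (capmxSr _ _).
Qed.

(** By dimension, [U] shares a nonzero vector with the subspace where the form is at most
    [lambda i A] times the squared norm. *)
Lemma lambda_ge m A i c (U : 'M[R]_(m, n)) : A^T = A -> (1 <= i <= n)%N ->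
  (i <= \rank U)%N ->
  (forall v, (v <= U)%MS -> c * dot v v <= dot (v *m A) v) -> c <= lambda i A.
Proof.
move=> Asym i_n rkU UP; have [_ [W [rkW WP]]] := lambda_subspaces Asym i_n.
have [|v [v0 vU vW]] := @capmx_nonzero _ _ U W; first lia.
by have := le_trans (UP v vU) (WP v vW); rewrite ler_pM2r ?dot_gt0.
Qed.

(** The top eigenspaces of [A] serve as test subspace for [B]. *)
Lemma lambda_mono_scaled A B i a b : A^T = A -> B^T = B -> (1 <= i <= n)%N ->
  0 <= a -> 0 < b ->
  (forall v, a * dot (v *m A) v <= b * dot (v *m B) v) ->
  a * lambda i A <= b * lambda i B.
Proof.
move=> Asym Bsym i_n a0 b0 AB.
have [[U [rkU UP]] _] := lambda_subspaces Asym i_n.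
rewrite -ler_pdivrMl // mulrA; apply: (lambda_ge Bsym i_n rkU) => v vU.
rewrite -!mulrA ler_pdivrMl //; apply: le_trans (AB v).
by rewrite ler_wpM2l ?UP.
Qed.

End CourantFischer.

(** * Spectral norm and quadratic forms *)

Section OperatorNorm.

Variable R : realType.

Lemma norm2_dot n (v : 'rV[R]_n) : norm2 v^T = Num.sqrt (dot v v).
Proof.
rewrite /norm2 dotE; congr Num.sqrt.
by apply: eq_bigr => i _; rewrite mxE expr2.
Qed.

Lemma norm2_0 n : norm2 (0 : 'cV[R]_n) = 0.
Proof. by rewrite -trmx0 norm2_dot /dot mul0mx mxE sqrtr0. Qed.

(** Cauchy-Schwarz on each row gives the Frobenius norm as a bound, so that [sup] really is an upper
    bound of the set. *)
Lemma opnorm2_has_ubound m n (A : 'M[R]_(m, n)) :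
  has_ubound [set norm2 (A *m x) | x in [set x : 'cV[R]_n | norm2 x <= 1]].
Proof.
exists (Num.sqrt (\sum_i dot (row i A) (row i A))) => _ [x /= x1 <-].
rewrite /norm2 ler_wsqrtr // ler_sum // => i _.
have -> : (A *m x) i 0 = dot (row i A) x^T.
  by rewrite /dot trmxK -row_mul [RHS]mxE.
apply: le_trans (cauchy_schwarz _ _) _.
rewrite -[leRHS]mulr1 ler_wpM2l ?dot_ge0 //.
by rewrite -(ler_sqrt _ ler01) sqrtr1 -norm2_dot trmxK.
Qed.

Lemma norm2_mulmx_le m n (A : 'M[R]_(m, n)) (x : 'cV[R]_n) :
  norm2 (A *m x) <= opnorm2 A * norm2 x.
Proof.
rewrite -[x]trmxK; move: x^T => {x} v.
have normZ k a (w : 'rV[R]_k) : 0 <= a -> norm2 (a *: w^T) = a * norm2 w^T.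
  move=> a0; rewrite -[a *: _]trmxK [(a *: _)^T]linearZ /= trmxK !norm2_dot.
  by rewrite dotZl dotZr mulrA -expr2 sqrtrM ?sqr_ge0 // sqrtr_sqr ger0_norm.
have [->|v0] := eqVneq v 0.
  by rewrite trmx0 mulmx0 !norm2_0 mulr0.
have t0 : 0 < norm2 v^T by rewrite norm2_dot sqrtr_gt0 dot_gt0.
rewrite -ler_pdivrMr // mulrC.
apply: (ub_le_sup (opnorm2_has_ubound A)); exists ((norm2 v^T)^-1 *: v^T) => /=.
  by rewrite normZ ?mulVf ?gt_eqF ?invr_ge0 ?(ltW t0).
by rewrite -scalemxAr -[A *m _]trmxK normZ ?invr_ge0 ?(ltW t0).
Qed.

Lemma opnorm2_ge0 m n (A : 'M[R]_(m, n)) : 0 <= opnorm2 A.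
Proof.
have : norm2 (A *m (0 : 'cV_n)) <= opnorm2 A.
  by apply: (ub_le_sup (opnorm2_has_ubound A)); exists 0; rewrite //= norm2_0.
by rewrite mulmx0 norm2_0.
Qed.

(** Cauchy-Schwarz followed by |v A| <= |A| |v|; symmetry turns the row product into the column
    product measured by [opnorm2]. *)
Lemma dot_opnorm2_le n (A : 'M[R]_n) (v : 'rV[R]_n) : A^T = A ->
  `|dot (v *m A) v| <= opnorm2 A * dot v v.
Proof.
move=> Asym; have := norm2_mulmx_le A v^T.
have -> : A *m v^T = (v *m A)^T by rewrite trmx_mul Asym.
rewrite !norm2_dot => le_norm.
have := cauchy_schwarz (v *m A) v.
rewrite -ler_sqrt ?mulr_ge0 ?dot_ge0 // sqrtr_sqr sqrtrM ?dot_ge0 //.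
move=> /le_trans; apply; rewrite -{2}[dot v v]sqr_sqrtr ?dot_ge0 // expr2 mulrA.
by rewrite ler_wpM2r ?sqrtr_ge0.
Qed.

End OperatorNorm.

(** * Positive semidefinite square root *)

Section SquareRoot.

Variable R : realType.

Lemma psd_dot n (A : 'M[R]_n) (v : 'rV[R]_n) : psdmx A -> 0 <= dot (v *m A) v.
Proof. by case=> _ /(_ v^T); rewrite trmxK. Qed.

Lemma psdmx_dot n (A : 'M[R]_n) :
  A^T = A -> (forall v : 'rV[R]_n, 0 <= dot (v *m A) v) -> psdmx A.
Proof. by move=> Asym A0; split=> // x; have := A0 x^T; rewrite /dot trmxK. Qed.

Lemma psd_sqrt n (A : 'M[R]_n) : psdmx A -> exists S, psdmx S /\ S *m S = A.
Proof.
move=> Apsd; have [Q [D [QQ AE]]] := real_spectral (proj1 Apsd).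
(* The form evaluated at the [j]-th row of [Q] is exactly the [j]-th eigenvalue. *)
have D0 j : 0 <= D 0 j.
  have := psd_dot (delta_mx 0 j *m Q) Apsd.
  rewrite (spectral_dot _ AE) -mulmxA QQ mulmx1 (bigD1 j) //= big1 => [|k kj].
    by rewrite !mxE !eqxx expr1n mulr1 addr0.
  by rewrite mxE (negbTE kj) andbF expr0n mulr0.
pose E := map_mx Num.sqrt D.
exists (Q^T *m diag_mx E *m Q); split; last first.
  rewrite AE !mulmxA -[_ *m Q *m Q^T]mulmxA QQ mulmx1.
  rewrite -[_ *m diag_mx E *m diag_mx E]mulmxA.
  congr (_ *m _ *m _); rewrite mulmx_diag; congr diag_mx.
  by apply/rowP => j; rewrite !mxE -expr2 sqr_sqrtr.
apply: psdmx_dot => [|v]; first by rewrite !trmx_mul trmxK tr_diag_mx mulmxA.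
rewrite (spectral_dot _ (erefl _)).
by apply: sumr_ge0 => j _; rewrite mulr_ge0 ?sqr_ge0 // mxE sqrtr_ge0.
Qed.

(** Existence of a root ensures that [xget] returns one instead of its default. *)
Lemma sqrtmx_psd n (A : 'M[R]_n) : psdmx A ->
  psdmx (sqrtmx A) /\ sqrtmx A *m sqrtmx A = A.
Proof.
move=> Apsd; have [S SP] := psd_sqrt Apsd.
exact: (@xgetPex _ 0 [set S : 'M[R]_n | psdmx S /\ S *m S = A]
  (ex_intro _ S SP)).
Qed.

End SquareRoot.

(** * Ranks of preimages and images, and Gram matrices *)

Lemma lambda_psd_ge0 (R : realType) n (A : 'M[R]_n) i :
  psdmx A -> (1 <= i <= n)%N -> 0 <= lambda i A.
Proof.
move=> Apsd i_n; apply: (lambda_ge (U := 1%:M) (proj1 Apsd) i_n).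
  by rewrite mxrank1; case/andP: i_n.
by move=> v _; rewrite mul0r psd_dot.
Qed.

(** Membership of v Z in [W] amounts to v being killed by [Z *m cokermx W], whose rank is at most n
    - rank W. *)
Lemma preimage_subspace (F : fieldType) m n p
    (Z : 'M[F]_(m, n)) (W : 'M[F]_(p, n)) :
  exists V : 'M[F]_m, (m + \rank W <= n + \rank V)%N /\
    forall v : 'rV_m, (v <= V)%MS -> (v *m Z <= W)%MS.
Proof.
exists (kermx (Z *m cokermx W)); split.
  rewrite mxrank_ker; have := mxrankM_maxr Z (cokermx W).
  have := rank_leq_col W; have := rank_leq_row (Z *m cokermx W).
  by rewrite mxrank_coker; lia.
by move=> v /sub_kermxP; rewrite mulmxA submxE => ->.
Qed.

Lemma mxrank_mul_inj (F : fieldType) m n p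
    (V : 'M[F]_(m, n)) (B : 'M[F]_(n, p)) :
  (forall v : 'rV_n, (v <= V)%MS -> v *m B = 0 -> v = 0) ->
  \rank (V *m B) = \rank V.
Proof.
move=> inj; have := mxrank_mul_ker V B.
have -> : (V :&: kermx B)%MS = 0.
  apply/eqP/rowV0P => v; rewrite sub_capmx => /andP [vV /sub_kermxP].
  exact: inj.
by rewrite mxrank0 addn0.
Qed.

Lemma sample_cov_dot (R : realType) n d (X : 'M[R]_(n, d)) (v : 'rV[R]_d) :
  dot (v *m sample_cov X) v = n%:R^-1 * dot (v *m X^T) (v *m X^T).
Proof. by rewrite /sample_cov -scalemxAr dotZl mulmxA dot_mulmx. Qed.

Lemma sample_cov_psd (R : realType) n d (X : 'M[R]_(n, d)) :
  psdmx (sample_cov X).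
Proof.
apply: psdmx_dot => [|v].
  by rewrite /sample_cov linearZ /= trmx_mul trmxK.
by rewrite sample_cov_dot mulr_ge0 ?invr_ge0 ?ler0n ?dot_ge0.
Qed.

(** The form of Z Z^T / c - I at v is |v Z|^2 / c - |v|^2, hence at most e |v|^2 in absolute value.
    It is applied to Z^T with c = n and to Z with c = d. *)
Lemma gram_deviation (R : realType) n d (Z : 'M[R]_(n, d)) (c : R)
    (v : 'rV[R]_n) :
  0 < c ->
  let e := opnorm2 (c^-1 *: (Z *m Z^T) - 1%:M) in
  c * (1 - e) * dot v v <= dot (v *m Z) (v *m Z) <= c * (1 + e) * dot v v.
Proof.
move=> c0 /=; set e := opnorm2 _; pose H := c^-1 *: (Z *m Z^T) - 1%:M.
have Hsym : H^T = H by rewrite /H linearB /= linearZ /= trmx_mul trmxK trmx1.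
have := dot_opnorm2_le v Hsym.
have -> : dot (v *m H) v = c^-1 * dot (v *m Z) (v *m Z) - dot v v.
  by rewrite mulmxBr dotBl mulmx1 -scalemxAr dotZl mulmxA dot_mulmx trmxK.
rewrite -/e ler_norml => /andP [lo hi].
rewrite -!mulrA -ler_pdivlMl // -[X in _ && X]ler_pdivrMl //.
apply/andP; split; lra.
Qed.

(** * Comparison of the two spectra *)

Theorem theorem5 (R : realType) (n d : nat) (X Z : 'M[R]_(n, d))
    (Sigma : 'M[R]_d) (Sigma_psd : psdmx Sigma)
    (XZ : X = Z *m sqrtmx Sigma) :
  ((d <= n)%N -> forall i : nat, (1 <= i <= d)%N ->
     `|lambda i (sample_cov X) - lambda i Sigma|
       <= lambda i Sigma * opnorm2 (n%:R^-1 *: (Z^T *m Z) - 1%:M))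
  /\
  ((n <= d)%N -> forall i : nat, (1 <= i <= n)%N ->
     lambda (i + d - n) Sigma * (1 - opnorm2 (d%:R^-1 *: (Z *m Z^T) - 1%:M))
       <= n%:R / d%:R * lambda i (sample_cov X)
       <= lambda i Sigma * (1 + opnorm2 (d%:R^-1 *: (Z *m Z^T) - 1%:M))).
Proof.
have [[Ssym _]] := sqrtmx_psd Sigma_psd.
move: (sqrtmx Sigma) XZ Ssym => S XZ Ssym SS.
have Sigma_sym := proj1 Sigma_psd.
have [cov_sym _] := sample_cov_psd X.
have Sigma_dot (v : 'rV_d) : dot (v *m Sigma) v = dot (v *m S) (v *m S).
  by rewrite -SS mulmxA dot_mulmx Ssym.
have cov_dot (v : 'rV_d) :
    n%:R * dot (v *m sample_cov X) v = dot (v *m S *m Z^T) (v *m S *m Z^T).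
  rewrite sample_cov_dot XZ trmx_mul Ssym mulmxA mulrA.
  (* For n = 0 the product of n and its inverse is 0, not 1, but the right-hand side is then an
     empty sum. *)
  have [n0|n0] := posnP n; last by rewrite divff ?mul1r // pnatr_eq0 -lt0n.
  rewrite {1}n0 !mul0r; move: Z {XZ}; rewrite n0 => Z'.
  by rewrite dotE big_ord0.
split=> [le_dn i i_d|le_nd i i_n].
  have n0 : 0 < n%:R :> R by rewrite ltr0n; lia.
  have dev (v : 'rV_d) := gram_deviation Z^T (v *m S) n0.
  move: dev; rewrite /= trmxK.
  have := opnorm2_ge0 (n%:R^-1 *: (Z^T *m Z) - 1%:M).
  move: (opnorm2 _) => e e0 dev.
  have S0 := lambda_psd_ge0 Sigma_psd i_d.
  have C0 := lambda_psd_ge0 (sample_cov_psd X) i_d.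
  have hi : 1 * lambda i (sample_cov X) <= (1 + e) * lambda i Sigma.
    apply: lambda_mono_scaled => // [|v]; first by rewrite ltr_wpDr.
    have /andP [_] := dev v.
    by rewrite mul1r -cov_dot -Sigma_dot -mulrA ler_pM2l.
  have lo : (1 - e) * lambda i Sigma <= 1 * lambda i (sample_cov X).
    (* For e >= 1 the left side is nonpositive; otherwise 1 - e is an admissible scaling factor. *)
    have [e1|e1] := leP 1 e.
      by apply: le_trans (mulr_ge0 ler01 C0); rewrite mulr_le0_ge0 // subr_le0.
    apply: lambda_mono_scaled => // [|v]; first by rewrite subr_ge0 ltW.
    have /andP [+ _] := dev v.
    by rewrite mul1r -cov_dot -Sigma_dot -mulrA ler_pM2l.
  by rewrite ler_norml; apply/andP; split; lra.
have n0 : 0 < n%:R :> R by rewrite ltr0n; lia.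
have d0 : 0 < d%:R :> R by rewrite ltr0n; lia.
have dev (v : 'rV_n) := gram_deviation Z v d0.
move: dev; rewrite /=; have := opnorm2_ge0 (d%:R^-1 *: (Z *m Z^T) - 1%:M).
move: (opnorm2 _) => e e0 dev.
have i_d : (1 <= i <= d)%N by lia.
(* The truncated subtraction is exact because n <= d. *)
have j_d : (1 <= i + d - n <= d)%N by lia.
have S0 := lambda_psd_ge0 Sigma_psd j_d.
have C0 := lambda_psd_ge0 (sample_cov_psd X) i_d.
apply/andP; split; last first.
  rewrite mulrAC ler_pdivrMr // -mulrA [leRHS]mulrC.
  apply: lambda_mono_scaled => // [|v]; first by rewrite mulr_gt0 // ltr_wpDr.
  (* The bound on [Z] passes to [Z^T] because [|w Z^T|^2 = <w Z^T Z, w>]. *)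
  rewrite cov_dot Sigma_dot; set w := v *m S; set y := w *m Z^T.
  have [y0|y0] := eqVneq (dot y y) 0.
    by rewrite y0 !mulr_ge0 ?dot_ge0 ?addr_ge0 ?ler01 // ltW.
  have y_gt0 : 0 < dot y y by rewrite lt_def y0 dot_ge0.
  (* |y|^4 <= |w|^2 |y Z|^2 <= |w|^2 (1 + e) d |y|^2, and one factor |y|^2 cancels. *)
  rewrite -(ler_pM2r y_gt0) -expr2.
  have yy : dot y y = dot w (y *m Z) by rewrite {1}/y dot_mulmx trmxK.
  rewrite {1}yy.
  apply: le_trans (cauchy_schwarz _ _) _.
  have /andP [_ le_yZ] := dev y.
  rewrite [(1 + e) * _]mulrC [_ * dot w w]mulrC -mulrA.
  by rewrite ler_wpM2l ?dot_ge0.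
(* A nonpositive left side is trivial; otherwise e < 1 and the constant [c] below is positive. *)
have [c0|c0] := leP (lambda (i + d - n) Sigma * (1 - e)) 0.
  by apply: le_trans c0 _; rewrite mulr_ge0 // divr_ge0 // ltW.
have e1 : 0 < 1 - e.
  by rewrite ltNge; apply: contraTN c0 => e1; rewrite -leNgt mulr_ge0_le0.
have [[W [rkW WP]] _] := lambda_subspaces Sigma_sym j_d.
(* The rank of [V] is at least n + (i + d - n) - d = i. *)
have [V [rkV VP]] := preimage_subspace Z W.
set mu := lambda (i + d - n) Sigma in c0 S0 WP *.
pose c := d%:R * (mu * (1 - e)).
have c_gt0 : 0 < c by rewrite mulr_gt0.
(* As y Z lies in [W], |y Z S|^2 >= mu |y Z|^2 >= mu d (1 - e) |y|^2. Since c > 0, this also makes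
   [Z *m S] injective on [V]. *)
have VB (y : 'rV_n) : (y <= V)%MS ->
    c * dot y y <= dot (y *m (Z *m S)) (y *m (Z *m S)).
  move=> /VP/WP; rewrite Sigma_dot mulmxA; apply: le_trans.
  have /andP [lo _] := dev y.
  by apply: le_trans (ler_wpM2l S0 lo); rewrite /c !mulrA [mu * _]mulrC.
have rk : \rank (V *m (Z *m S)) = \rank V.
  apply: mxrank_mul_inj => y yV y0; have := VB y yV.
  rewrite y0 {2}/dot mul0mx mxE pmulr_rle0 // => yy.
  by apply/eqP; rewrite -dot_eq0 eq_le yy dot_ge0.
rewrite mulrAC ler_pdivlMr // mulrC -/c -ler_pdivrMl //.
apply: (lambda_ge (U := V *m (Z *m S)) cov_sym i_d).
  by rewrite rk; move: (\rank _) (\rank _) rkV rkW => r s; lia.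
move=> x /submxP [y0 ->]; rewrite mulmxA; set y := y0 *m V; set w := y *m _.
have yV : (y <= V)%MS by exact: submxMl.
rewrite -mulrA ler_pdivrMl // cov_dot.
(* [|w|^2 = <w S Z^T, y>], so Cauchy-Schwarz turns the lower bound
   [c |y|^2 <= |w|^2] into [c |w|^2 <= |w S Z^T|^2]. *)
have ww : dot w w = dot (w *m S *m Z^T) y.
  by rewrite {1}/w dot_mulmx trmx_mul Ssym mulmxA dotC.
have [w0|w0] := eqVneq (dot w w) 0; first by rewrite w0 mulr0 dot_ge0.
have w_gt0 : 0 < dot w w by rewrite lt_def w0 dot_ge0.
have := cauchy_schwarz (w *m S *m Z^T) y; rewrite -ww expr2 => cs.
rewrite -(ler_pM2r w_gt0) -mulrA.
apply: le_trans (ler_wpM2l (ltW c_gt0) cs) _.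
by rewrite mulrCA ler_wpM2l ?dot_ge0 ?VB.
Qed.
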